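(* Let $S$ be a Hausdorff semitopological semigroup, let $\mathcal{F}$ be an m-admissible subalgebra of $\mathcal{CB}(S)$, and let $\mathcal{R}=\{\mathcal{A}^{\mu}:\mu\in S^{\mathcal{F}}\}$ be the associated semigroup compactification of $S$ realized by filters. Let $\mathcal{A}\subseteq Z(\mathcal{F})$ be a filter such that $\overline{\mathcal{A}}$ is a left ideal of $\mathcal{R}$. If $\overline{\mathcal{A}}$ is a minimal left ideal of $\mathcal{R}$, then for any $A\in Z(\mathcal{F})$, $\Omega_{\mathcal{A}}(A)=S$ implies $\overline{\mathcal{A}}\subseteq\overline{A}$.
   Context: Setting. $\mathcal{CB}(S)$ is the $C^*$-algebra of bounded continuous complex-valued functions on the Hausdorff semitopological semigroup $S$ (sup norm). A subalgebra $\mathcal{F}\subseteq\mathcal{CB}(S)$ is m-admissible if it is norm-closed, closed under conjugation, contains the constants, is invariant under the translations $(L_sf)(t)=f(st)$ and $(R_sf)(t)=f(ts)$, and $\mathbf{T}_\mu f\in\mathcal{F}$ for all $f\in\mathcal{F}$, $\mu\in S^{\mathcal{F}}$; here $S^{\mathcal{F}}$ is the set of multiplicative means on $\mathcal{F}$ with the Gelfand (weak$^*$) topology and $(\mathbf{T}_\mu f)(s)=\mu(L_sf)$. $S^{\mathcal{F}}$ is a compact Hausdorff right topological semigroup under $(\mu\nu)(f)=\mu(\mathbf{T}_\nu f)$; $\varepsilon:S\to S^{\mathcal{F}}$, $\varepsilon(s)(f)=f(s)$, is a continuous homomorphism with dense image. Filters. For $f\in\mathcal{F}$, $Z(f)=f^{-1}(\{0\})$,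 and $Z(\mathcal{F})=\{Z(f):f\in\mathcal{F}\}$. A filter (z-filter) is a set $\mathcal{A}\subseteq Z(\mathcal{F})$ with $\emptyset\notin\mathcal{A}$, $S\in\mathcal{A}$, closed under finite intersections and under supersets in $Z(\mathcal{F})$. $\mathcal{F}S$ is the set of z-ultrafilters (maximal z-filters). For each $p\in\mathcal{F}S$ there is a unique $\mu\in S^{\mathcal{F}}$ with $\bigcap_{A\in p}\overline{\varepsilon(A)}=\{\mu\}$ (closures in $S^{\mathcal{F}}$), and each $\mu$ arises from some $p$. Put $p\sim q$ if $p,q$ give the same $\mu$, let $[p]$ be the equivalence class of $p$, $\widetilde p=\bigcap[p]$, and $\mathcal{A}^\mu=\widetilde p$ when $p$ gives $\mu$. Set $\mathcal{R}=\{\widetilde p:p\in\mathcal{F}S\}=\{\mathcal{A}^\mu:\mu\in S^{\mathcal{F}}\}$. The map $\mu\mapsto\mathcal{A}^\mu$ is a bijection $S^{\mathcal{F}}\to\mathcal{R}$, which is an isomorphism and homeomorphism; so $\mathcal{A}^\mu*\mathcal{A}^\nu=\mathcal{A}^{\mu\nu}$, and the topology of $\mathcal{R}$ has base $\{\mathcal{R}\setminus\overline{A}:A\in Z(\mathcal{F})\}$, where $\overline{A}=\{\widetilde p:p\in\mathcal{F}S,\ A\in p\}$ for $A\in Z(\mathcal{F})$. For a filter $\mathcal{A}$, $\overline{\mathcal{A}}=\{\widetilde p:p\in\mathcal{F}S,\ \mathcal{A}\subseteq p\}\subseteq\mathcal{R}$. For $x\in S$, $\lambda_x:S\to S$ is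 $\lambda_x(t)=xt$ (so $\lambda_x^{-1}(Z(f))=Z(L_xf)\in Z(\mathcal{F})$). For a filter $\mathcal{A}$ and $A\in Z(\mathcal{F})$, $\Omega_{\mathcal{A}}(A)=\{x\in S:\overline{\mathcal{A}}\subseteq\overline{\lambda_x^{-1}(A)}\}$. *)

(* Defs.v *)
From HB Require Import structures.
From mathcomp Require Import all_boot all_order all_algebra.
From mathcomp Require Import all_classical all_reals all_analysis.
From mathcomp Require Import complex.

Set Implicit Arguments.
Unset Strict Implicit.
Unset Printing Implicit Defensive.

Import Order.TTheory GRing.Theory Num.Theory.
Import numFieldNormedType.Exports.
Import ComplexField.

Local Open Scope classical_set_scope.
Local Open Scope ring_scope.
Local Open Scope complex_scope.

(* Hausdorff separation is not part of the structure. *)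
HB.mixin Record isSemitopological S of Topological S & Semigroup S := {
  continuous_mulgl : forall s : S, continuous (fun t : S => (s * t)%g);
  continuous_mulgr : forall s : S, continuous (fun t : S => (t * s)%g)
}.

#[short(type="semitopSemigroupType")]
HB.structure Definition SemitopSemigroup :=
  { S of isSemitopological S & Topological S & Semigroup S }.

Section FunctionAlgebras.
Variables (R : realType) (S : semitopSemigroupType).
Implicit Types (f g : S -> R[i]) (s t : S) (c : R[i]).

(* The topology of the complex plane is the one of R[i]^o, R[i] seen as a
   normed space over itself. *)
Definition CB : set (S -> R[i]) :=
  [set f | continuous (f : S -> R[i]^o) /\
           exists M : R, forall s, Normc.normc (f s) <= M].

(* The sup is taken in R, so it is meaningful for bounded f only. *)
Definition supnorm f : R := sup (range (fun s => Normc.normc (f s))).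

Definition ltransl s f : S -> R[i] := fun t => f (s * t)%g.
Definition rtransl s f : S -> R[i] := fun t => f (t * s)%g.

Record translation_algebra := TranslationAlgebra {
  carrier :> set (S -> R[i]);
  sub_CB : carrier `<=` CB;
  carrierD : forall f g, carrier f -> carrier g -> carrier (fun t => f t + g t);
  carrierM : forall f g, carrier f -> carrier g -> carrier (fun t => f t * g t);
  carrierZ : forall c f, carrier f -> carrier (fun t => c * f t);
  carrier_cst : forall c, carrier (fun=> c);
  carrier_conj : forall f, carrier f -> carrier (fun t => (f t)^*);
  carrier_closed : forall f, CB f ->
    (forall e : R, 0 < e ->
      exists2 g, carrier g & supnorm (fun t => f t - g t) < e) ->
    carrier f;
  carrier_ltransl : forall s f, carrier f -> carrier (ltransl s f);
  carrier_rtransl : forall s f, carrier f -> carrier (rtransl s f)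
}.

Section Means.
Variable F : translation_algebra.
Implicit Types u v : set_type F.

Definition elt f (Ff : carrier F f) : set_type F := exist _ f (mem_set Ff).

Definition addF u v := elt (carrierD (set_valP u) (set_valP v)).
Definition mulF u v := elt (carrierM (set_valP u) (set_valP v)).
Definition scaleF c u := elt (carrierZ c (set_valP u)).
Definition oneF := elt (carrier_cst F 1).
Definition ltranslF s u := elt (carrier_ltransl s (set_valP u)).

(* {ptws _ -> _} is the topology of pointwise convergence on F, so that the
   subspace topology on this set is the weak* (Gelfand) topology.  The
   conditions other than the third say that mu is a mean, i.e. a linear
   functional with ||mu|| = mu 1 = 1. *)
Definition mult_mean : set {ptws (set_type F) -> R[i]^o} :=
  [set mu | [/\ forall u v, mu (addF u v) = mu u + mu v,
                forall c u, mu (scaleF c u) = c * mu u,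
                forall u v, mu (mulF u v) = mu u * mu v,
                forall u, Normc.normc (mu u) <= supnorm (set_val u) &
                mu oneF = 1]].

Definition meanT (mu : set_type F -> R[i]) u : S -> R[i] :=
  fun s => mu (ltranslF s u).

End Means.

Record m_admissible := MAdmissible {
  algebra :> translation_algebra;
  carrier_meanT : forall mu, mult_mean (F := algebra) mu ->
    forall u : set_type algebra, carrier algebra (meanT mu u)
}.

End FunctionAlgebras.

Section Spectrum.
Variables (R : realType) (S : semitopSemigroupType) (F : m_admissible R S).
Implicit Types (s t : S) (u v : set_type F).

Definition spectrum : topologicalType := set_type (mult_mean (F := F)).
Implicit Types mu nu : spectrum.

Lemma set_valF_inj : injective (set_val : set_type F -> (S -> R[i])).
Proof. exact: val_inj. Qed.

Lemma normc_le_supnorm u s : Normc.normc (set_val u s) <= supnorm (set_val u).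
Proof.
have [_ [M uM]] := sub_CB (set_valP u).
apply: sup_upper_bound; last by exists s.
split; first by exists (Normc.normc (set_val u s)), s.
by exists M => _ [t _ <-]; exact: uM.
Qed.

Fact eps_subproof s :
  mult_mean (F := F) (fun u : set_type F => set_val u s).
Proof. by split=> // u; exact: normc_le_supnorm. Qed.

Definition to_spectrum phi (phiP : mult_mean (F := F) phi) : spectrum :=
  exist (fun psi => psi \in mult_mean (F := F)) phi (mem_set phiP).

Definition eps s : spectrum := to_spectrum (eps_subproof s).

Definition meanTF mu u : set_type F :=
  elt (carrier_meanT (set_valP mu) u).

Fact mulmean_subproof mu nu :
  mult_mean (F := F) (fun u => set_val mu (meanTF nu u)).
Proof.
have [muD muZ muM muN mu1] := set_valP mu.
have [nuD nuZ nuM nuN nu1] := set_valP nu.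
split.
- move=> u v; rewrite -muD; congr (set_val mu _); apply: set_valF_inj.
  apply/funext => s; apply: etrans (nuD (ltranslF s u) (ltranslF s v)).
  by congr (set_val nu _); exact: set_valF_inj.
- move=> c u; rewrite -muZ; congr (set_val mu _); apply: set_valF_inj.
  apply/funext => s; apply: etrans (nuZ c (ltranslF s u)).
  by congr (set_val nu _); exact: set_valF_inj.
- move=> u v; rewrite -muM; congr (set_val mu _); apply: set_valF_inj.
  apply/funext => s; apply: etrans (nuM (ltranslF s u) (ltranslF s v)).
  by congr (set_val nu _); exact: set_valF_inj.
- move=> u; apply: (le_trans (muN _)).
  have [[s0 _]|S0] := pselect (exists s : S, True); last first.
    rewrite /supnorm; suff -> : set_val (meanTF nu u) = set_val u by [].
    by apply/funext => s; case: S0; exists s.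
  apply: ge_sup; first by exists (Normc.normc (set_val (meanTF nu u) s0)), s0.
  move=> _ [s _ <-]; apply: (le_trans (nuN _)); apply: ge_sup.
    by exists (Normc.normc (set_val (ltranslF s u) s0)), s0.
  by move=> _ [t _ <-]; exact: (normc_le_supnorm u (s * t)%g).
- rewrite -mu1; congr (set_val mu _); apply: set_valF_inj.
  apply/funext => s; apply: etrans nu1.
  by congr (set_val nu _); exact: set_valF_inj.
Qed.

Definition mulmean mu nu : spectrum :=
  to_spectrum (mulmean_subproof mu nu).

End Spectrum.

Section Filters.
Variables (R : realType) (S : semitopSemigroupType) (F : m_admissible R S).
Implicit Types (A B : set S) (p q : set (set S)).

Definition zeroset (f : S -> R[i]) : set S := f @^-1` [set 0].

Definition zerosets : set (set S) := [set zeroset f | f in carrier F].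

Definition zfilter p : Prop :=
  [/\ p `<=` zerosets, ~ p set0, p setT,
      forall A B, p A -> p B -> p (A `&` B) &
      forall A B, p A -> zerosets B -> A `<=` B -> p B].

Definition zultrafilter p : Prop :=
  zfilter p /\ forall q, zfilter q -> p `<=` q -> q = p.

Definition gives p (mu : spectrum F) : Prop :=
  \bigcap_(A in p) closure (eps F @` A) = [set mu].

Definition zequiv p q : Prop := exists mu, gives p mu /\ gives q mu.

Definition zclass p : set (set (set S)) :=
  [set q | zultrafilter q /\ zequiv p q].

Definition tilde p : set (set S) := \bigcap_(q in zclass p) q.

(* The filter A^mu; see filter_ofE. *)
Definition filter_of (mu : spectrum F) : set (set S) :=
  \bigcap_(q in [set q | zultrafilter q /\ gives q mu]) q.

Lemma filter_ofE p mu : gives p mu -> filter_of mu = tilde p.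
Proof.
move=> pmu; congr bigcap; apply/seteqP; split=> q [qu].
  by move=> qmu; split => //; exists mu.
move=> [nu [pnu qnu]]; split => //; suff <- : nu = mu by [].
by have : [set nu] nu by []; rewrite -pnu pmu.
Qed.

Definition RR : set (set (set S)) := [set tilde p | p in zultrafilter].

(* A^mu * A^nu = A^(mu nu).  Since mu |-> A^mu is a bijection from the
   spectrum onto RR, there is exactly one such c when a and b are in RR; the
   default value set0 is only used outside of RR. *)
Definition mulRR (a b : set (set S)) : set (set S) :=
  xget set0 [set c | exists mu nu : spectrum F,
    [/\ a = filter_of mu, b = filter_of nu & c = filter_of (mulmean mu nu)]].

Definition left_ideal (L : set (set (set S))) : Prop :=
  [/\ L `<=` RR, L !=set0 & forall a b, RR a -> L b -> L (mulRR a b)].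

Definition minimal_left_ideal (L : set (set (set S))) : Prop :=
  left_ideal L /\ forall L', left_ideal L' -> L' `<=` L -> L' = L.

Definition set_hull A : set (set (set S)) :=
  [set tilde p | p in [set p | zultrafilter p /\ p A]].

Definition filter_hull (a : set (set S)) : set (set (set S)) :=
  [set tilde p | p in [set p | zultrafilter p /\ a `<=` p]].

Definition Omega (a : set (set S)) A : set S :=
  [set x | filter_hull a `<=` set_hull ((fun t : S => (x * t)%g) @^-1` A)].

End Filters.

(* Main.v *)
(* Identify mu with A^mu.  Then filter_hull a becomes the set of the mu that are
   adherent to every member of a, and set_hull A the closure of A in the
   spectrum.  Fix mu in the left ideal L = filter_hull a.  The hypothesis on
   Omega says that mu is in the closure of x^-1 A, i.e. that eps(x) mu is in the
   closure of A, for every x in S; by density of eps(S) the whole left ideal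
   S^F mu lies in the closure of A, and by minimality it is equal to L.

   The topology of the spectrum is handled through kernels: mu is in the closure
   of A iff every u in F with mu u = 0 takes arbitrarily small values on A.  The
   sets {|u| <= e} with mu u = 0 play the role of neighbourhoods of mu; they are
   zero sets because F, being norm-closed, is stable under u |-> |u|. *)
Require Import Defs.
From mathcomp Require Import all_boot all_order all_algebra.
From mathcomp Require Import all_classical all_reals all_analysis.
From mathcomp Require Import complex.
From mathcomp Require Import ring lra.

Set Implicit Arguments.
Unset Strict Implicit.
Unset Printing Implicit Defensive.

Import Order.TTheory GRing.Theory Num.Theory.
Import numFieldNormedType.Exports.
Import ComplexField Normc.

Local Open Scope classical_set_scope.
Local Open Scope ring_scope.
Local Open Scope complex_scope.

(** * The complex modulus and a polynomial iteration for it *)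

Section ComplexModulus.
Variable R : realType.

Lemma normC_normc (z : R[i]) : `|z| = (normc z)%:C.
Proof. by []. Qed.

Lemma mul_conjc (z : R[i]) : z * z^* = (normc z ^+ 2)%:C.
Proof. by rewrite -sqr_normc normC_normc rmorphXn. Qed.

Lemma normc_ge0 (z : R[i]) : 0 <= normc z.
Proof. by case: z => x y; exact: sqrtr_ge0. Qed.

Lemma normcR (x : R) : normc x%:C = `|x|.
Proof. by rewrite /normc /= expr0n addr0 sqrtr_sqr. Qed.

(* An iteration for the square root of [y ^+ 2]: it only uses [y ^+ 2] and ring
   operations, and converges to [y] uniformly on [0, 1]. *)
Fixpoint sqrt_iter (y : R) n : R :=
  if n is m.+1 then let q := sqrt_iter y m in q + (y ^+ 2 - q ^+ 2) / 2
  else 0.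

(** The third bound carries the rate. With [q >= 0], one step multiplies the error [y - q] by
    [1 - (y + q) / 2 <= 1 - y / 2], and [(1 - y / 2) * (2 + (n + 1) * y) <= 2 + n * y]. *)
Lemma sqrt_iter_bounds (y : R) n : 0 <= y <= 1 ->
  [/\ 0 <= sqrt_iter y n, sqrt_iter y n <= y &
      (y - sqrt_iter y n) * (2 + n%:R * y) <= 2 * y].
Proof.
move=> /andP[y0 y1]; elim: n => [|n [q0 qy qd]] /=.
  by rewrite subr0 mul0r addr0 mulrC lexx.
set q := sqrt_iter y n in q0 qy qd *.
have n0 : 0 <= n%:R :> R by [].
have d0 : 0 <= y - q by rewrite subr_ge0.
split; [nra|nra|apply: le_trans qd].
rewrite -natr1.
set k := n%:R in n0 *.
have -> : y - (q + (y ^+ 2 - q ^+ 2) / 2) = (y - q) * (1 - (y + q) / 2) by field.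
rewrite -mulrA ler_wpM2l//.
have ky : 0 <= k * y by exact: mulr_ge0.
nra.
Qed.

Lemma sqrt_iter_cvg (y : R) n : 0 <= y <= 1 ->
  `|y - sqrt_iter y n.+1| <= 2 / n.+1%:R.
Proof.
move=> y01; have [q0 qy] := sqrt_iter_bounds n.+1 y01.
have /andP[y0 y1] := y01.
set k := n.+1%:R; have k0 : 0 < k :> R by [].
set q := sqrt_iter y n.+1 in q0 qy * => qd.
rewrite ger0_norm ?subr_ge0// ler_pdivlMr//.
(* The rate gives [(y - q) * k * y <= 2 * y], from which [y] has to be cancelled. *)
have [y00|yn0] := eqVneq y 0; first by nra.
have yp : 0 < y by rewrite lt_neqAle eq_sym yn0.
rewrite -(ler_pM2r yp); nra.
Qed.

End ComplexModulus.

(** * Stability of [F] under the modulus *)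

Section Algebra.
Variables (R : realType) (S : semitopSemigroupType).
Variable F : translation_algebra R S.
Implicit Types f g : S -> R[i].

Lemma supnorm_le f (c : R) : 0 <= c ->
  (forall s, normc (f s) <= c) -> supnorm f <= c.
Proof.
move=> c0 fc; rewrite /supnorm.
(* If [S] is empty the supremum takes the default value 0, whence the assumption [0 <= c]. *)
have [->|/set0P E] := eqVneq (range (fun s => normc (f s))) set0.
  by rewrite sup0.
by apply: ge_sup => // _ [s _ <-].
Qed.

Lemma carrierB f g : carrier F f -> carrier F g ->
  carrier F (fun s => f s - g s).
Proof.
move=> Ff Fg; have := carrierD Ff (carrierZ (-1) Fg).
by congr carrier; apply/funext => s; rewrite mulN1r.
Qed.

Lemma carrier_bounded f : carrier F f ->
  exists2 M : R, 0 < M & forall s, normc (f s) <= M.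
Proof.
move=> /sub_CB[_ [M fM]]; exists (Num.max 1 M).
  by rewrite lt_max ltr01.
by move=> s; rewrite le_max fM orbT.
Qed.

Lemma carrier_sqr_norm f : carrier F f ->
  carrier F (fun s => (normc (f s) ^+ 2)%:C).
Proof.
move=> Ff; have := carrierM Ff (carrier_conj Ff).
by congr carrier; apply/funext => s; rewrite mul_conjc.
Qed.

Lemma carrier_sqrt_iter f n : carrier F f ->
  carrier F (fun s => (sqrt_iter (normc (f s)) n)%:C).
Proof.
move=> Ff; elim: n => [|n Fn]; first exact: (carrier_cst F 0).
have := carrierD Fn (carrierZ (2^-1)%:C
  (carrierB (carrier_sqr_norm Ff) (carrierM Fn Fn))).
congr carrier; apply/funext => s /=.
by rewrite -rmorphM -rmorphB -rmorphM -rmorphD/= -expr2 [2^-1 * _]mulrC.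
Qed.

(** After rescaling to [|f| <= 1], the iterates are polynomials in [|f|^2 = f * f^*], hence in [F],
    and they converge uniformly to [|f|]; norm-closedness concludes. *)
Lemma carrier_norm f : carrier F f -> carrier F (fun s => (normc (f s))%:C).
Proof.
move=> Ff.
wlog f1 : f Ff / forall s, normc (f s) <= 1.
  move=> H; have [M M0 fM] := carrier_bounded Ff.
  have nE s : normc ((M^-1)%:C * f s) = M^-1 * normc (f s).
    by rewrite normcM normcR ger0_norm// invr_ge0 ltW.
  have := carrierZ M%:C (H _ (carrierZ (M^-1)%:C Ff) _).
  have H1 s : normc ((M^-1)%:C * f s) <= 1.
    by rewrite nE mulrC ler_pdivrMr// mul1r.
  move=> /(_ H1); congr carrier; apply/funext => s.
  by rewrite nE -rmorphM mulrA divff ?mul1r ?gt_eqF.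
have [fc [M fM]] := sub_CB Ff.
apply: carrier_closed => [|e e0].
  split; last by exists M => s; rewrite normcR ger0_norm ?normc_ge0.
  by move=> s; apply: (@cvg_norm R[i] R[i]^o); exact: fc.
have e20 : 0 < e / 2 by rewrite divr_gt0.
(* This makes [2 / n.+1 < e / 2]; halving [e] leaves room for the strict inequality required of the
   sup norm. *)
pose n := Num.truncn (2 / (e / 2)).
exists (fun s => (sqrt_iter (normc (f s)) n.+1)%:C); first exact: carrier_sqrt_iter.
apply: (@le_lt_trans _ _ (e / 2)); last by lra.
apply: supnorm_le => [|s]; first exact: ltW.
rewrite -rmorphB normcR.
apply: le_trans (sqrt_iter_cvg _ _) _; first by rewrite normc_ge0 f1.
rewrite ler_pdivrMr// mulrC -ler_pdivrMr//; apply: ltW.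
by rewrite -/n truncnS_gt.
Qed.

End Algebra.

(** * Zero sets of [F] *)

Section Zerosets.
Variables (R : realType) (S : semitopSemigroupType) (F : m_admissible R S).

(** With [k = |f| - e], the function [k + |k|] is twice the positive part of [k] and vanishes
    exactly where [k <= 0]. *)
Lemma zerosets_normc_le (f : S -> R[i]) (e : R) : carrier F f ->
  zerosets F [set s | normc (f s) <= e].
Proof.
move=> Ff; have Fg := carrierB (carrier_norm Ff) (carrier_cst F e%:C).
exists (fun s => ((normc (f s))%:C - e%:C) + (normc ((normc (f s))%:C - e%:C))%:C).
  exact: carrierD Fg (carrier_norm Fg).
pose k s := normc (f s) - e.
rewrite (_ : (fun s => _) = fun s => (k s + `|k s|)%:C); last first.
  by apply/funext => s; rewrite -rmorphB normcR -rmorphD.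
apply/seteqP; split=> s; rewrite /zeroset /preimage /mkset -subr_le0 -/(k s).
  by move=> -[/eqP]; rewrite addrC addr_eq0 ; rewrite ler0_def.
by move=> ks; rewrite ler0_norm ?addrN.
Qed.

Lemma zerosets_setT : zerosets F setT.
Proof.
exists (fun=> 0); first exact: carrier_cst.
by apply/seteqP; split.
Qed.

Lemma zerosets_setI A B : zerosets F A -> zerosets F B -> zerosets F (A `&` B).
Proof.
move=> [f Ff <-] [g Fg <-].
exists (fun s => (normc (f s))%:C + (normc (g s))%:C).
  exact: carrierD (carrier_norm Ff) (carrier_norm Fg).
apply/seteqP; split=> s; rewrite /zeroset /preimage /setI /mkset -rmorphD.
  move=> -[/eqP]; rewrite paddr_eq0 ?normc_ge0// => /andP[/eqP f0 /eqP g0].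
  by split; exact: eq0_normc.
by move=> [-> ->]; rewrite normc0 addr0.
Qed.

End Zerosets.

(** The pointwise topology is the supremum of those induced by the evaluations, which are surjective
    because constant functions exist. *)
Lemma ptws_cvg (T U : Type) (V : topologicalType) (G : set_system T)
    (h : T -> U -> V) (f : U -> V) : Filter G ->
  (forall u, h ^~ u @ G --> f u) -> {ptws, h @ G --> f}.
Proof.
move=> FG hf; apply/cvg_sup => u; apply/cvg_image.
  by rewrite eqEsubset; split=> v // _; exists (cst v).
move=> W /hf GW; exists (@^~ u @^-1` W) => //.
by rewrite image_preimage // eqEsubset; split=> // v _; exists (cst v).
Qed.

(** * Multiplicative means and closures in the spectrum *)

Section Means.
Variables (R : realType) (S : semitopSemigroupType) (F : m_admissible R S).
Implicit Types (A B : set S) (u v : set_type F) (mu nu : spectrum F) (e : R).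

Lemma mean_oneF mu : set_val mu (oneF F) = 1.
Proof. by have [] := set_valP mu. Qed.

Lemma meanD mu u v : set_val mu (addF u v) = set_val mu u + set_val mu v.
Proof. have [+ _ _ _ _] := set_valP mu; apply. Qed.

Lemma meanZ mu c u : set_val mu (scaleF c u) = c * set_val mu u.
Proof. have [_ + _ _ _] := set_valP mu; apply. Qed.

Lemma meanM mu u v : set_val mu (mulF u v) = set_val mu u * set_val mu v.
Proof. have [_ _ + _ _] := set_valP mu; apply. Qed.

Lemma mean_le_supnorm mu u : normc (set_val mu u) <= supnorm (set_val u).
Proof. have [_ _ _ + _] := set_valP mu; apply. Qed.

Lemma meanZ0 mu : set_val mu (scaleF 0 (oneF F)) = 0.
Proof. by rewrite meanZ mul0r. Qed.

Definition centre mu u := addF u (scaleF (- set_val mu u) (oneF F)).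

Lemma centreE mu u s : set_val (centre mu u) s = set_val u s - set_val mu u.
Proof. by rewrite -[LHS]/(_ + _ * 1) mulr1. Qed.

Lemma mean_centre mu u : set_val mu (centre mu u) = 0.
Proof. by rewrite meanD meanZ mean_oneF mulr1 addrN. Qed.

Definition sqr_normF u := mulF u (elt (carrier_conj (set_valP u))).

Lemma sqr_normFE u s : set_val (sqr_normF u) s = (normc (set_val u s) ^+ 2)%:C.
Proof. exact: mul_conjc. Qed.

Lemma mean_sqr_normF mu u : set_val mu u = 0 -> set_val mu (sqr_normF u) = 0.
Proof. by move=> u0; rewrite meanM u0 mul0r. Qed.

Definition adherent mu A := forall u, set_val mu u = 0 ->
  forall e, 0 < e -> exists2 s, A s & normc (set_val u s) < e.

Lemma adherent_sub mu A B : A `<=` B -> adherent mu A -> adherent mu B.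
Proof.
by move=> AB muA u u0 e e0; have [s /AB Bs us] := muA _ u0 _ e0; exists s.
Qed.

(** This is the density of [eps(S)]. An element of the kernel bounded away from 0 would produce an
    element of [F] whose mean exceeds its sup norm. *)
Lemma adherent_setT mu : adherent mu setT.
Proof.
move=> u u0 e e0; apply: contrapT => H.
have ue s : e <= normc (set_val u s).
  by rewrite leNgt; apply/negP => us; apply: H; exists s.
have [M M0 uM] : exists2 M, 0 < M & forall s, normc (set_val u s) <= M :=
    carrier_bounded (set_valP u).
(* [w = 1 - |u|^2 / M^2] has sup norm < 1 although [mu w = 1]. *)
pose w := addF (oneF F) (scaleF (- (M ^- 2)%:C) (sqr_normF u)).
have wE s : set_val w s = (1 - (normc (set_val u s) / M) ^+ 2)%:C.
  rewrite -[LHS]/(1 + (- (M ^- 2)%:C) * set_val (sqr_normF u) s) sqr_normFE.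
  by rewrite mulNr -rmorphM -(rmorph1 (real_complex R)) -rmorphB expr_div_n mulrC.
have muw : set_val mu w = 1.
  by rewrite meanD mean_oneF meanZ mean_sqr_normF// mulr0 addr0.
have : supnorm (set_val w) < 1.
  (* The maximum with 0 covers an empty [S], where nothing compares [e] with [M]. *)
  apply: (@le_lt_trans _ _ (Num.max 0 (1 - (e / M) ^+ 2))); last first.
    by rewrite gt_max ltr01 ltrBlDr ltrDl exprn_gt0// divr_gt0.
  apply: supnorm_le => [|s]; first by rewrite le_max lexx.
  rewrite wE normcR le_max; apply/orP; right.
  rewrite ger0_norm; last first.
    rewrite subr_ge0 expr_le1// ?divr_ge0 ?normc_ge0 ?(ltW M0)//.
    by rewrite ler_pdivrMr// mul1r.
  rewrite lerD2l lerN2 lerXn2r ?nnegrE ?divr_ge0 ?normc_ge0 ?(ltW M0) ?(ltW e0)//.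
  by rewrite ler_pM2r ?invr_gt0.
by apply/negP; rewrite -leNgt -(normc1 R) -muw mean_le_supnorm.
Qed.

(** Neighbourhoods of [mu] given by kernel elements form a filter base: [|u|^2 + |v|^2] stays in the
    kernel by multiplicativity and dominates both squares. *)
Lemma small_near_mean mu u v e d : set_val mu u = 0 -> set_val mu v = 0 ->
    0 < e -> 0 < d ->
  exists2 w, set_val mu w = 0 & exists2 c, 0 < c &
    forall s, normc (set_val w s) < c ->
      normc (set_val u s) < e /\ normc (set_val v s) < d.
Proof.
move=> u0 v0 e0 d0; exists (addF (sqr_normF u) (sqr_normF v)).
  by rewrite meanD !mean_sqr_normF// addr0.
exists (Num.min e d ^+ 2); first by rewrite exprn_gt0// lt_min e0.
move=> s; rewrite -[set_val _ s]/(set_val (sqr_normF u) s +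
  set_val (sqr_normF v) s).
rewrite !sqr_normFE -rmorphD normcR ger0_norm ?addr_ge0 ?sqr_ge0// => H.
have m0 : 0 <= Num.min e d by rewrite le_min !ltW.
have [me md] : Num.min e d <= e /\ Num.min e d <= d by rewrite !ge_min !lexx orbT.
have us := normc_ge0 (set_val u s); have vs := normc_ge0 (set_val v s).
split; [apply: lt_le_trans me|apply: lt_le_trans md];
  rewrite -(@ltr_pXn2r _ 2)//; apply: le_lt_trans H;
  by rewrite ?lerDl ?lerDr sqr_ge0.
Qed.

(** Left to right, [|nu u| < e] defines a neighbourhood of [mu]. Conversely, the traces on [A] of
    the sets [|u| < e] with [mu u = 0] generate a filter whose image under [eps] converges to
    [mu]. *)
Lemma adherentP mu A : closure (eps F @` A) mu <-> adherent mu A.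
Proof.
split=> [muA u u0 e e0|muA V muV].
  have : nbhs mu [set nu : spectrum F | normc (set_val nu u) < e].
    have ev : continuous (fun nu : spectrum F => set_val nu u : R[i]^o).
      move=> nu; apply: (@continuous_comp _ _ _ set_val
        (fun phi : {ptws (set_type F) -> R[i]^o} => phi u)).
        exact: initial_continuous.
      exact: (@proj_continuous (set_type F) (fun=> R[i]^o)).
    have /cvgrPdist_lt /(_ e%:C) := ev mu.
    rewrite ltcR => /(_ e0); apply: filterS => nu /=.
    by rewrite u0 sub0r normrN normC_normc ltcR.
  by move=> /muA[_ [[s As <-] us]]; exists s.
pose D := [set ue : set_type F * R | set_val mu ue.1 = 0 /\ 0 < ue.2].
pose N (ue : set_type F * R) := [set s | A s /\ normc (set_val ue.1 s) < ue.2].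
pose G := filter_from D N.
have GF : Filter G.
  apply: filter_from_filter.
    by exists (scaleF 0 (oneF F), 1); split=> //=; exact: meanZ0.
  move=> [u e] [v d] [/= u0 e0] [/= v0 d0].
  have [w w0 [c c0 wc]] := small_near_mean u0 v0 e0 d0.
  by exists (w, c) => // s [/= As /wc[us vs]]; split; split.
have Gmu : (eps F @ G) --> mu.
  have : {ptws, (fun s => set_val (eps F s)) @ G --> (set_val mu : _ -> R[i]^o)}.
    apply: ptws_cvg => u; apply/cvgrPdist_lt => e e0.
    have eR : e = (complex.Re e)%:C by rewrite RRe_real// gtr0_real.
    (* Subtracting the constant [mu u] turns convergence of [u] to [mu u] into smallness of a kernel
       element. *)
    exists (centre mu u, complex.Re e).
      by split; [exact: mean_centre|rewrite -ltcR -eR].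
    move=> s [_]/=; rewrite centreE => us.
    by rewrite /= distrC normC_normc eR ltcR.
  move=> H W; rewrite nbhsE => -[U [[U' oU' <-] U'mu] UW].
  have /H : nbhs (set_val mu : {ptws (set_type F) -> R[i]^o}) U'.
    exact: open_nbhs_nbhs.
  rewrite !nbhs_simpl /=; apply: (@filterS _ G) => s; exact: UW.
have [[u e] [/= u0 e0] Nue] := Gmu _ muV.
have [s As us] := muA _ u0 _ e0.
by exists (eps F s); split; [exists s|apply: Nue].
Qed.

End Means.

(** * Z-ultrafilters and the means they give *)

Section ZFilters.
Variables (R : realType) (S : semitopSemigroupType) (F : m_admissible R S).
Implicit Types (A B C : set S) (p q a : set (set S)).
Implicit Types (u v : set_type F) (mu nu : spectrum F) (e : R).

Definition generated_by (base : set (set S)) : set (set S) :=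
  [set C | zerosets F C /\ exists2 B, base B & B `<=` C].

Lemma zfilter_generated_by (base : set (set S)) : base !=set0 ->
    (forall B, base B -> B !=set0) ->
    (forall A B, base A -> base B -> exists2 C, base C & C `<=` A `&` B) ->
  zfilter F (generated_by base).
Proof.
move=> [B0 bB0] base0 baseI; split.
- by move=> C [].
- by move=> [_ [B /base0[s Bs] /(_ s Bs)]].
- by split; [exact: zerosets_setT|exists B0].
- move=> A B [zA [A' bA' AA']] [zB [B' bB' BB']].
  split; first exact: zerosets_setI.
  have [C bC CI] := baseI _ _ bA' bB'.
  by exists C => // s /CI[/AA' As /BB' Bs].
- move=> A B [zA [A' bA' AA']] zB AB; split=> //.
  by exists A' => //; exact: subset_trans AB.
Qed.

Lemma zfilter_neq0 p B : zfilter F p -> p B -> B !=set0.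
Proof.
by move=> [_ p0 _ _ _] pB; apply/set0P/eqP => B0; apply: p0; rewrite -B0.
Qed.

Lemma zultrafilter_exists p : zfilter F p ->
  exists2 q, zultrafilter F q & p `<=` q.
Proof.
(* Zorn's lemma also tests the empty chain; adjoining [p] makes its union correspond to [p]
   itself. *)
move=> pf; pose P q := zfilter F (p `|` q).
have P0 : P set0 by rewrite /P setU0.
have [Q QP Qtot|A [PA Amax]] := @Zorn_bigcup _ P.
  have common A B : (p `|` \bigcup_(X in Q) X) A ->
      (p `|` \bigcup_(X in Q) X) B ->
      exists X, [/\ P X, X `<=` \bigcup_(X in Q) X, (p `|` X) A & (p `|` X) B].
    move=> [pA|[X QX XA]] [pB|[Y QY YB]].
    - by exists set0; split=> //; left.
    - by exists Y; split; [exact: QP|exact: bigcup_sup|left|right].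
    - by exists X; split; [exact: QP|exact: bigcup_sup|right|left].
    - have [XY|YX] := Qtot _ _ QX QY.
        by exists Y; split; [exact: QP|exact: bigcup_sup|right; exact: XY|right].
      by exists X; split; [exact: QP|exact: bigcup_sup|right|right; exact: YX].
  split.
  - by move=> A pA; have [X [[+ _ _ _ _] _ + _]] := common _ _ pA pA; apply.
  - by move=> p0; have [X [[_ + _ _ _] _ + _]] := common _ _ p0 p0.
  - by left; have [] := pf.
  - move=> A B pA pB; have [X [[_ _ _ XI _] XQ XA XB]] := common _ _ pA pB.
    by apply: (setUS XQ); exact: XI.
  - move=> A B pA zB AB; have [X [[_ _ _ _ Xup] XQ XA _]] := common _ _ pA pA.
    by apply: (setUS XQ); exact: Xup XA zB AB.
exists (p `|` A) => //; split=> // q qf Aq.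
apply/seteqP; split=> //; apply: subset_trans (@subsetUr _ p A).
apply: contrapT => qA; apply: (Amax q).
  by split=> //; exact: subset_trans Aq.
by rewrite /P setUidr//; apply: subset_trans Aq.
Qed.

(** The traces on [C] of the members of [p] generate a z-filter extending [p] and containing [C]; by
    maximality it is [p]. *)
Lemma zultrafilter_mem p C : zultrafilter F p -> zerosets F C ->
  (forall B, p B -> (B `&` C) !=set0) -> p C.
Proof.
move=> [pf pmax] zC meetC; have [pz _ pT pI _] := pf.
pose q := generated_by [set B `&` C | B in p].
have qf : zfilter F q.
  apply: zfilter_generated_by; first by exists (setT `&` C), setT.
    by move=> _ [B pB <-]; exact: meetC.
  move=> _ _ [A pA <-] [B pB <-]; exists (A `&` B `&` C).
    by exists (A `&` B) => //; exact: pI.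
  by move=> s [[? ?] ?].
rewrite -(pmax q qf); first by split=> //; exists (setT `&` C) => //; exists setT.
by move=> B pB; split; [exact: pz|exists (B `&` C) => //; exists B].
Qed.

Definition small u e : set S := [set s | normc (set_val u s) <= e].

Lemma zerosets_small u e : zerosets F (small u e).
Proof. exact: zerosets_normc_le (set_valP u). Qed.

Lemma adherent_small mu B u e : adherent mu B -> set_val mu u = 0 -> 0 < e ->
  (B `&` small u e) !=set0.
Proof.
by move=> muB u0 e0; have [s Bs /ltW us] := muB _ u0 _ e0; exists s.
Qed.

(** If the means differed at [w] by a distance [d], two members of [p] would meet in a point where
    [w] is within [d / 3] of both values. *)
Lemma zfilter_small_inj p mu nu : zfilter F p ->
    (forall u e, set_val mu u = 0 -> 0 < e -> p (small u e)) ->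
    (forall u e, set_val nu u = 0 -> 0 < e -> p (small u e)) ->
  mu = nu.
Proof.
move=> pf pmu pnu; apply: val_inj; apply/funext => w.
apply: contrapT => munu; have [_ _ _ pI _] := pf.
pose d := normc (set_val mu w - set_val nu w).
have d0 : 0 < d.
  rewrite lt_neqAle normc_ge0 andbT; apply/eqP => /esym /eq0_normc dw.
  by apply: munu; apply: subr0_eq.
have d30 : 0 < d / 3 by rewrite divr_gt0.
have [s []] := zfilter_neq0 pf (pI _ _ (pmu _ _ (mean_centre mu w) d30)
  (pnu _ _ (mean_centre nu w) d30)).
rewrite /small/= !centreE => mus nus.
suff : d <= d / 3 + d / 3 by lra.
apply: le_trans (lerD nus mus).
rewrite -(normcN (_ - set_val mu w)); apply: le_trans (le_normcD _ _).
by rewrite opprB addrC addrA subrK.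
Qed.

Lemma zultrafilter_small p mu u e : zultrafilter F p ->
    (forall B, p B -> adherent mu B) -> set_val mu u = 0 -> 0 < e ->
  p (small u e).
Proof.
move=> pu pmu u0 e0; apply: zultrafilter_mem pu (zerosets_small u e) _ => B pB.
exact: adherent_small (pmu _ pB) u0 e0.
Qed.

(** Uniqueness of the adherent mean comes from maximality: [p] contains every [small u e] attached
    to a mean adherent to all its members. *)
Lemma givesP p mu : zultrafilter F p ->
  gives p mu <-> (forall B, p B -> adherent mu B).
Proof.
move=> pu; split=> [pmu B pB|pmu].
  apply/adherentP; have : [set mu] mu by [].
  by rewrite -pmu; apply.
apply/seteqP; split=> [nu pnu|_ -> B pB]; last exact/adherentP/pmu.
apply: (@zfilter_small_inj p); first by have [] := pu.
  move=> u e; apply: zultrafilter_small => // B pB; exact/adherentP/pnu.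
by move=> u e; exact: zultrafilter_small.
Qed.

Lemma zultrafilter_gives a mu : zfilter F a ->
    (forall B, a B -> adherent mu B) ->
  exists p, [/\ zultrafilter F p, a `<=` p & gives p mu].
Proof.
(* Adjoin to [a] the neighbourhoods [small u e] of [mu], then extend to a z-ultrafilter. Taking
   [u = 0] recovers the members of [a] themselves. *)
move=> [az a0 aT aI aup] amu.
pose base := [set C | exists B u e,
  [/\ a B, set_val mu u = 0, 0 < e & C = B `&` small u e]].
have z0 := meanZ0 mu.
have bf : zfilter F (generated_by base).
  apply: zfilter_generated_by.
  - by exists (setT `&` small (scaleF 0 (oneF F)) 1), setT, (scaleF 0 (oneF F)), 1.
  - by move=> _ [B [u [e [aB u0 e0 ->]]]]; exact: adherent_small (amu _ aB) u0 e0.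
  - move=> _ _ [A [u [e [aA u0 e0 ->]]]] [B [v [d [aB v0 d0 ->]]]].
    have [w w0 [c c0 wc]] := small_near_mean u0 v0 e0 d0.
    (* [small] is defined by a large inequality; half of [c] gives the strict one. *)
    exists (A `&` B `&` small w (c / 2)).
      by exists (A `&` B), w, (c / 2); split; rewrite ?divr_gt0//; exact: aI.
    move=> s [[As Bs] ws]; have /wc[us vs] : normc (set_val w s) < c.
      by apply: le_lt_trans ws _; lra.
    by split; split=> //; exact: ltW.
have [p pu bp] := zultrafilter_exists bf.
exists p; split=> // [B aB|].
  apply: bp; split; first exact: az.
  exists (B `&` small (scaleF 0 (oneF F)) 1); last exact: subIsetl.
  by exists B, (scaleF 0 (oneF F)), 1.
apply/givesP => // B pB u u0 e e0; have [pf _] := pu; have [_ _ _ pI _] := pf.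
have [|s [Bs us]] := zfilter_neq0 pf (pI B (small u (e / 2)) pB _).
  apply: bp; split; first exact: zerosets_small.
  exists (setT `&` small u (e / 2)) => [|s []//].
  by exists setT, u, (e / 2); rewrite divr_gt0.
by exists s => //; apply: le_lt_trans us _; lra.
Qed.

End ZFilters.

(** * Limits of bounded functions along ultrafilters *)

Section UltrafilterLimits.
Variables (R : realType) (T : Type) (G : set_system T) (GU : UltraFilter G).

Lemma bounded_ultra_cvg (r : T -> R) (M : R) : (forall t, `|r t| <= M) ->
  exists x, forall e, 0 < e -> G [set t | `|r t - x| < e].
Proof.
move=> rM; have GP : ProperFilter G by exact: ultra_proper.
have rMM : (r @ G) `[- M, M]%classic.
  by apply: (@filterE _ G) => t; rewrite /= in_itv /= -ler_norml; exact: rM.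
have [x [_ clx]] := segment_compact _ rMM; exists x => e e0.
(* A cluster point [x] exists by compactness; were the complement in [G], it would stay away from
   the ball around [x]. *)
have [//|Gn] := in_ultra_setVsetC [set t | `|r t - x| < e] GU.
have [y [/= ye xe]] : ([set y | ~ `|y - x| < e] `&` ball x e) !=set0.
  by apply: clx; [exact: Gn|exact: nbhsx_ballx].
by case: ye; rewrite distrC.
Qed.

Lemma bounded_complex_ultra_cvg (f : T -> R[i]) (M : R) :
  (forall t, normc (f t) <= M) -> exists c : R[i]^o, f @ G --> c.
Proof.
move=> fM; have GP : ProperFilter G by exact: ultra_proper.
have le_normc (z : R[i]) :
    `|complex.Re z| <= normc z /\ `|complex.Im z| <= normc z.
  case: z => x y /=; rewrite -!sqrtr_sqr.
  by split; rewrite ler_wsqrtr// ?lerDl ?lerDr sqr_ge0.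
have [t|x rx] := @bounded_ultra_cvg (fun t => complex.Re (f t)) M.
  by apply: le_trans (fM t); have [] := le_normc (f t).
have [t|y ry] := @bounded_ultra_cvg (fun t => complex.Im (f t)) M.
  by apply: le_trans (fM t); have [] := le_normc (f t).
exists (x +i* y); apply/(@cvgrPdist_lt R[i] R[i]^o) => e e0.
have eR : e = (complex.Re e)%:C by rewrite RRe_real// gtr0_real.
have e20 : 0 < complex.Re e / 2 by rewrite divr_gt0// -ltcR -eR.
apply: filterS2 (rx _ e20) (ry _ e20) => t /= tx ty.
rewrite distrC normC_normc eR ltcR.
have -> : f t - (x +i* y) =
    (complex.Re (f t) - x)%:C + 'i%C * (complex.Im (f t) - y)%:C.
  by rewrite [LHS]complexE; case: (f t).
apply: le_lt_trans (le_normcD _ _) _; rewrite normcM !normcR.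
have -> : normc 'i%C = 1 :> R by rewrite /normc/= expr0n expr1n add0r sqrtr1.
by rewrite mul1r; lra.
Qed.

End UltrafilterLimits.

(** * Identification of the spectrum with [RR] *)

Section FilterRealization.
Variables (R : realType) (S : semitopSemigroupType) (F : m_admissible R S).
Implicit Types (A B C : set S) (p q a : set (set S)).
Implicit Types (u v : set_type F) (mu nu : spectrum F) (e : R).

(** This plays the role of compactness of the spectrum: limits along [G] exist by boundedness and
    inherit the identities and the norm bound of point evaluations. *)
Lemma ultra_mean (G : set_system S) : UltraFilter G ->
  exists mu, forall u, (set_val u : S -> R[i]^o) @ G --> set_val mu u.
Proof.
move=> GU; have GP : ProperFilter G by exact: ultra_proper.
have /choice[phi phiP] : forall u, exists c : R[i]^o, set_val u @ G --> c.
  move=> u; have [M _ uM] := carrier_bounded (set_valP u).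
  exact: (@bounded_complex_ultra_cvg _ _ _ _ (set_val u) M).
have phiE u (c : R[i]^o) : (set_val u : S -> R[i]^o) @ G --> c -> phi u = c.
  by move=> uc; apply: (@cvg_unique _ (@norm_hausdorff _ R[i]^o)) (phiP u) uc.
suff phim : mult_mean (F := F) phi by exists (to_spectrum phim).
split.
- by move=> u v; apply: phiE; exact: (@cvgD _ R[i]^o) (phiP u) (phiP v).
- move=> c u; apply: phiE.
  exact: (@cvgM R[i]) (@cvg_cst R[i]^o c _ _ _) (phiP u).
- by move=> u v; apply: phiE; exact: (@cvgM R[i]) (phiP u) (phiP v).
- move=> u; apply/ler_addgt0Pr => e e0.
  have /(@cvgrPdist_lt R[i] R[i]^o) /(_ e%:C) := phiP u.
  rewrite ltcR => /(_ e0) /filter_ex[s].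
  rewrite /= normC_normc ltcR => us.
  rewrite -(subrK (set_val u s) (phi u)) addrC.
  by apply: le_trans (le_normcD _ _) _; rewrite lerD ?normc_le_supnorm// ltW.
- by apply: phiE; exact: cvg_cst.
Qed.

(** Extend [p] to an ultrafilter of arbitrary subsets of [S]; its limit mean is adherent to every
    member of [p]. *)
Lemma zultrafilter_spectrum p : zultrafilter F p -> exists mu, gives p mu.
Proof.
move=> pu; have [pf _] := pu; have [_ _ pT pI _] := pf.
have pP : ProperFilter (filter_from p id).
  apply: filter_from_proper; last by move=> B; exact: (zfilter_neq0 pf).
  apply: filter_from_filter; first by exists setT.
  by move=> A B pA pB; exists (A `&` B) => //; exact: pI.
have [G [GU pG]] := ultraFilterLemma pP.
have GP : ProperFilter G by exact: ultra_proper.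
have [mu muG] := ultra_mean GU; exists mu; apply/givesP => // B pB u u0 e e0.
have /(@cvgrPdist_lt R[i] R[i]^o) /(_ e%:C) := muG u.
rewrite u0 ltcR => /(_ e0) Gu.
have GB : G B by apply: pG; exists B.
have [s [Bs]] := filter_ex (filterI GB Gu).
by rewrite /= sub0r normrN normC_normc ltcR; exists s.
Qed.

Lemma filter_of_small mu u e : set_val mu u = 0 -> 0 < e ->
  filter_of mu (small u e).
Proof.
by move=> u0 e0 p [pu /givesP pmu]; apply: (zultrafilter_small pu (pmu pu)).
Qed.

Lemma zfilter_setT : S -> zfilter F [set setT].
Proof.
move=> s; split.
- by move=> _ ->; exact: zerosets_setT.
- by move=> /= /seteqP[_ /(_ s)]; apply.
- by [].
- by move=> _ _ -> ->; rewrite setIT.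
- by move=> _ B -> _ TB; apply/seteqP; split.
Qed.

Lemma mean_zultrafilter mu : exists2 p, zultrafilter F p & gives p mu.
Proof.
(* The existence of a mean forces [S] to be nonempty, so that the trivial filter is a z-filter. *)
have [s _ _] := adherent_setT (meanZ0 mu) ltr01.
have [B ->|p [pu _ pmu]] := zultrafilter_gives (mu := mu) (zfilter_setT s).
  exact: adherent_setT.
by exists p.
Qed.

(** [filter_of mu] contains all the sets [small u e] with [mu u = 0], and a single z-filter cannot
    contain those of two means. *)
Lemma filter_of_inj : injective (@filter_of R S F).
Proof.
move=> mu nu munu; have [p pu pmu] := mean_zultrafilter mu.
have sub : filter_of mu `<=` p by apply: bigcap_inf.
apply: (@zfilter_small_inj _ _ _ p); first by have [] := pu.
  by move=> u e u0 e0; apply: sub; exact: filter_of_small.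
by move=> u e u0 e0; apply: sub; rewrite munu; exact: filter_of_small.
Qed.

Lemma RR_filter_of mu : RR F (filter_of mu).
Proof.
by have [p pu pmu] := mean_zultrafilter mu; exists p => //;
   rewrite (filter_ofE pmu).
Qed.

Lemma RRP c : RR F c -> exists mu, c = filter_of mu.
Proof.
move=> [p pu <-]; have [mu pmu] := zultrafilter_spectrum pu.
by exists mu; rewrite (filter_ofE pmu).
Qed.

(** Injectivity of [filter_of] leaves only one candidate for the choice in [mulRR]. *)
Lemma mulRR_filter_of mu nu :
  mulRR F (filter_of mu) (filter_of nu) = filter_of (mulmean mu nu).
Proof.
rewrite /mulRR; case: xgetP => [c _
  [mu' [nu' [/filter_of_inj <- /filter_of_inj <- ->]]]//|].
by move=> /(_ (filter_of (mulmean mu nu))) []; exists mu, nu.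
Qed.

Lemma set_hull_adherent A mu : set_hull F A (filter_of mu) -> adherent mu A.
Proof.
move=> [p [pu pA] pmu]; have [nu pnu] := zultrafilter_spectrum pu.
move: pmu; rewrite -(filter_ofE pnu) => /filter_of_inj <-.
by move/givesP : pnu => /(_ pu); apply.
Qed.

(** The z-filter generated by [A] extends to a z-ultrafilter giving [mu]. *)
Lemma adherent_set_hull A mu : zerosets F A -> adherent mu A ->
  set_hull F A (filter_of mu).
Proof.
move=> zA muA.
have [||q [qu Aq qmu]] :=
  @zultrafilter_gives _ _ _ (generated_by F [set A]) mu.
- apply: zfilter_generated_by; first by exists A.
    by move=> _ ->; have [s As _] := muA _ (meanZ0 mu) _ ltr01; exists s.
  by move=> _ _ -> ->; exists A => //; rewrite setIid.
- by move=> B [_ [_ -> AB]]; exact: adherent_sub AB muA.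
exists q; last by rewrite (filter_ofE qmu).
by split=> //; apply: Aq; split=> //; exists A.
Qed.

Lemma mulmeanA mu nu xi :
  mulmean mu (mulmean nu xi) = mulmean (mulmean mu nu) xi.
Proof.
apply: val_inj; apply/funext => u /=.
congr (set_val mu _); apply: set_valF_inj; apply/funext => s /=.
congr (set_val nu _); apply: set_valF_inj; apply/funext => t /=.
congr (set_val xi _); apply: set_valF_inj; apply/funext => r /=.
by rewrite -[LHS]/(set_val u (s * (t * r))%g) mulgA.
Qed.

Lemma adherent_mulmean A mu nu :
  (forall x, adherent mu ((fun t => (x * t)%g) @^-1` A)) ->
  adherent (mulmean nu mu) A.
Proof.
move=> muA u u0 e e0; have e20 : 0 < e / 2 by rewrite divr_gt0.
(* By definition of the product, [meanTF mu u] is in the kernel of [nu]. Density gives [x] with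
   [mu (L_x u)] small, then adherence of [mu] to the preimage of [A] gives [t] with [u (x * t)]
   close to that value. *)
have [x _ ux] := adherent_setT (u0 : set_val nu (meanTF mu u) = 0) e20.
have [t At ut] := muA x _ (mean_centre mu (ltranslF x u)) _ e20.
exists (x * t)%g => //; move: ut; rewrite centreE => ut.
rewrite -(subrK (set_val mu (ltranslF x u)) (set_val u (x * t)%g)).
apply: le_lt_trans (le_normcD _ _) _.
by rewrite [e in _ < e]splitr ltrD.
Qed.

End FilterRealization.

Theorem corollary3p19 (R : realType) (S : semitopSemigroupType)
    (hausdorffS : hausdorff_space S) (F : m_admissible R S)
    (a : set (set S)) (filter_a : zfilter F a)
    (ideal_a : left_ideal F (filter_hull F a)) :
  minimal_left_ideal F (filter_hull F a) ->
  forall A : set S, zerosets F A ->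
    Omega F a A = setT -> filter_hull F a `<=` set_hull F A.
Proof.
move=> [_ minimal_a] A zA OmegaT.
have [aRR [b ab] aM] := ideal_a.
have [mu bE] := RRP (aRR _ ab); rewrite {}bE in ab.
(* The left ideal generated by multiplying [mu] on the left; it lies in the hull, which absorbs left
   products, so minimality makes the two equal. *)
pose L := range (fun nu : spectrum F => filter_of (mulmean nu mu)).
have <- : L = filter_hull F a.
  apply: minimal_a.
    split.
    - by move=> _ [nu _ <-]; exact: RR_filter_of.
    - by exists (filter_of (mulmean mu mu)), mu.
    - move=> c _ /RRP[xi ->] [nu _ <-]; exists (mulmean xi nu) => //.
      by rewrite mulRR_filter_of mulmeanA.
  move=> _ [nu _ <-]; rewrite -mulRR_filter_of; apply: aM => //.
  exact: RR_filter_of.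
move=> _ [nu _ <-]; apply: adherent_set_hull => //.
apply: adherent_mulmean => x; apply: set_hull_adherent.
by have : setT x by []; rewrite -OmegaT; apply.
Qed.
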